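(* For every formula $A$ of $\mathcal{L}_{PAL}$, if the DHS $\Rightarrow A$ (a single dynamic sequent consisting of the single $\epsilon$-labelled component with empty antecedent and succedent $A$) is derivable in $\mathbf{DHS}_{PAL}$, then $\vDash_{PAL} A$.
   Context: Formulas of $\mathcal{L}_{PAL}$ are generated by $A ::= p \mid \neg A \mid (A\wedge A) \mid \Box A \mid [A]A$ from a countable set of atoms. Semantics: an epistemic model is $M=(W,\sim,V)$ with $W$ a set, $\sim$ an equivalence relation on $W$, $V$ assigning to each atom a subset of $W$. Satisfaction and updated models are defined simultaneously: $M,w\vDash p$ iff $w\in V(p)$; $M,w\vDash\neg A$ iff not $M,w\vDash A$; $M,w\vDash A\wedge B$ iff both; $M,w\vDash\Box A$ iff $M,v\vDash A$ for all $v$ with $w\sim v$; $M,w\vDash[A]B$ iff ($M,w\vDash A$ implies $M_A,w\vDash B$), where $M_A=(W_A,\sim_A,V_A)$ with $W_A=\{w\in W: M,w\vDash A\}$, $\sim_A = \sim\cap W_A^2$, $V_A(p)=V(p)\cap W_A$. $\vDash_{PAL}A$ means $M,w\vDash A$ for all models $M$ and worlds $w$. Syntax of the calculus: a list of announcements is a finite (possibly empty, $\epsilon$) sequence of formulas, $\alpha\cdot A$ its extension by $A$. A sequent is $M\Rightarrow N$ ($M,N$ finite multisets); $A,\Gamma$ / $\Gamma,A$ add $A$ to antecedent / succedent. A dynamic sequent is $/\!/_{\alpha_1}\Gamma_1/\!/\cdots/\!/_{\alpha_n}\Gamma_n$ (components labelled by lists of announcements; $/\!/_\epsilon\Gamma$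 written $\Gamma$); a DHS is $X_1\mid\cdots\mid X_n$ of dynamic sequents. $G\mid X/\!/_\alpha M\Rightarrow N$ denotes a DHS with a dynamic sequent having component labelled $\alpha$ equal to $M\Rightarrow N$, $X$ the rest of that dynamic sequent and $G$ the rest of the DHS (possibly empty). Calculus $\mathbf{DHS}_{PAL}$: Axioms $G\mid X/\!/_\alpha p,M\Rightarrow N,p$. (L$\neg$) $G\mid X/\!/_\alpha M\Rightarrow N,A$ / $G\mid X/\!/_\alpha\neg A,M\Rightarrow N$; (R$\neg$) $G\mid X/\!/_\alpha A,M\Rightarrow N$ / $G\mid X/\!/_\alpha M\Rightarrow N,\neg A$; (L$\wedge$) $G\mid X/\!/_\alpha A,B,M\Rightarrow N$ / $G\mid X/\!/_\alpha A\wedge B,M\Rightarrow N$; (R$\wedge$) $G\mid X/\!/_\alpha M\Rightarrow N,A$ and $G\mid X/\!/_\alpha M\Rightarrow N,B$ / $G\mid X/\!/_\alpha M\Rightarrow N,A\wedge B$; (L$\Box_1$) $G\mid X/\!/_\alpha\Box A,A,M\Rightarrow N$ / $G\mid X/\!/_\alpha\Box A,M\Rightarrow N$; (R$\Box$) $G\mid X/\!/_\alpha M\Rightarrow N\mid/\!/_\alpha\Rightarrow A$ / $G\mid X/\!/_\alpha M\Rightarrow N,\Box A$; (L$\Box_2$) $G\mid X/\!/_\alpha\Box A,M\Rightarrow N\mid Y/\!/_\alpha A,P\Rightarrow Q$ / $G\mid X/\!/_\alpha\Box A,M\Rightarrow N\mid Y/\!/_\alpha P\Rightarrow Q$; (L$\Box_3$)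 with $\beta=B_1\cdots B_n$, $\overline{Y}=Y/\!/_{\alpha\cdot\beta}\Box A,\Delta$: premises $G\mid X/\!/_\alpha\Gamma,B_1\mid\overline{Y}$, $G\mid X/\!/_\alpha\Gamma/\!/_{\alpha\cdot B_1\cdots B_i}\Rightarrow B_{i+1}\mid\overline{Y}$ ($1\le i<n$), $G\mid X/\!/_\alpha\Gamma/\!/_{\alpha\cdot\beta}A\Rightarrow\ \mid\overline{Y}$, conclusion $G\mid X/\!/_\alpha\Gamma\mid Y/\!/_{\alpha\cdot\beta}\Box A,\Delta$; (L$[\cdot]$) $G\mid X/\!/_\alpha M\Rightarrow N,A/\!/_{\alpha\cdot A}M'\Rightarrow N'$ and $G\mid X/\!/_\alpha M\Rightarrow N/\!/_{\alpha\cdot A}B,M'\Rightarrow N'$ / $G\mid X/\!/_\alpha[A]B,M\Rightarrow N/\!/_{\alpha\cdot A}M'\Rightarrow N'$; (R$[\cdot]$) $G\mid X/\!/_\alpha A,M\Rightarrow N/\!/_{\alpha\cdot A}M'\Rightarrow N',B$ / $G\mid X/\!/_\alpha M\Rightarrow N,[A]B/\!/_{\alpha\cdot A}M'\Rightarrow N'$ (in both, if no $\alpha\cdot A$ component is in the conclusion, the premises — for (L$[\cdot]$) the right one — contain a new component $/\!/_{\alpha\cdot A}$ with $M',N'$ empty); (Lat) $G\mid X/\!/_\alpha p,M\Rightarrow N/\!/_{\alpha\cdot A}p,M'\Rightarrow N'$ / $G\mid X/\!/_\alpha M\Rightarrow N/\!/_{\alpha\cdot A}p,M'\Rightarrow N'$;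 (Rat) $G\mid X/\!/_\alpha M\Rightarrow N,p/\!/_{\alpha\cdot A}M'\Rightarrow N',p$ / $G\mid X/\!/_\alpha M\Rightarrow N/\!/_{\alpha\cdot A}M'\Rightarrow N',p$; (New) $G\mid X/\!/_\alpha\Rightarrow\ /\!/_{\alpha\cdot A}M\Rightarrow N$ / $G\mid X/\!/_{\alpha\cdot A}M\Rightarrow N$; (Recall) $G\mid X/\!/_\alpha A,M\Rightarrow N/\!/_{\alpha\cdot A}M'\Rightarrow N'$ / $G\mid X/\!/_\alpha M\Rightarrow N/\!/_{\alpha\cdot A}M'\Rightarrow N'$. (Notation ''premises / conclusion''.) *)

(* Defs.v *)
From HB Require Import structures.
From Stdlib Require Export RelationClasses.
From mathcomp Require Export all_boot.
From mathcomp Require Export finmap multiset.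

Set Implicit Arguments.
Unset Strict Implicit.
Unset Printing Implicit Defensive.

Local Open Scope mset_scope.

Inductive form (Atom : Type) : Type :=
| Var of Atom
| Neg of form Atom
| And of form Atom & form Atom
| Box of form Atom
| Ann of form Atom & form Atom.  (* [Ann A B] is [[A]B] *)

(* [{mset T}] requires a [choiceType]. *)
Fixpoint form_encode (Atom : Type) (A : form Atom) : GenTree.tree Atom :=
  match A with
  | Var p => GenTree.Leaf p
  | Neg B => GenTree.Node 0 [:: form_encode B]
  | And B C => GenTree.Node 1 [:: form_encode B; form_encode C]
  | Box B => GenTree.Node 2 [:: form_encode B]
  | Ann B C => GenTree.Node 3 [:: form_encode B; form_encode C]
  end.

Fixpoint form_decode (Atom : Type) (t : GenTree.tree Atom) :
    option (form Atom) :=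
  match t with
  | GenTree.Leaf p => Some (Var p)
  | GenTree.Node 0 [:: t1] => omap (@Neg Atom) (form_decode t1)
  | GenTree.Node 1 [:: t1; t2] =>
      obind (fun B => omap (And B) (form_decode t2)) (form_decode t1)
  | GenTree.Node 2 [:: t1] => omap (@Box Atom) (form_decode t1)
  | GenTree.Node 3 [:: t1; t2] =>
      obind (fun B => omap (Ann B) (form_decode t2)) (form_decode t1)
  | _ => None
  end.

Lemma form_encodeK (Atom : Type) :
  pcancel (@form_encode Atom) (@form_decode Atom).
Proof.
by elim=> [p|B IHB|B IHB C IHC|B IHB|B IHB C IHC] //=; rewrite IHB //= IHC.
Qed.

HB.instance Definition _ (Atom : countType) :=
  Countable.copy (form Atom) (pcan_type (@form_encodeK Atom)).

Record model (Atom : Type) := Model {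
  world : Type;
  acc : world -> world -> Prop;
  acc_equiv : Equivalence acc;
  val : Atom -> world -> Prop
}.

Lemma restrict_equiv (W : Type) (R : W -> W -> Prop) (P : W -> Prop) :
  Equivalence R ->
  Equivalence (fun u v : {w : W | P w} => R (proj1_sig u) (proj1_sig v)).
Proof.
case=> Rr Rs Rt; split.
- by move=> u; apply: Rr.
- by move=> u v; apply: Rs.
- by move=> u v w; apply: Rt.
Qed.

Definition restrict (Atom : Type) (M : model Atom) (P : world M -> Prop) :
    model Atom :=
  {| world := {w : world M | P w};
     acc := fun u v => acc (proj1_sig u) (proj1_sig v);
     acc_equiv := restrict_equiv P (acc_equiv M);
     val := fun p u => val p (proj1_sig u) |}.

(* The model varies through the recursion: the updated model [M_A] is
   [restrict (sat A)]. *)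
Fixpoint sat (Atom : Type) (A : form Atom) :
    forall M : model Atom, world M -> Prop :=
  match A with
  | Var p => fun M w => val p w
  | Neg B => fun M w => ~ sat B w
  | And B C => fun M w => sat B w /\ sat C w
  | Box B => fun M w => forall v : world M, acc w v -> sat B v
  | Ann B C => fun M w =>
      forall h : sat B w,
        @sat Atom C (restrict (fun u : world M => sat B u)) (exist _ w h)
  end.

Definition valid (Atom : Type) (A : form Atom) : Prop :=
  forall (M : model Atom) (w : world M), sat A w.

(* A component is a list of announcements together with the antecedent and the
   succedent of a sequent.  Both [//] and [|] are read as multiset union, so
   the order of components and of dynamic sequents is immaterial; distinct
   components of a dynamic sequent may carry the same label. *)
Definition component (Atom : countType) : Type :=
  (seq (form Atom) * ({mset form Atom} * {mset form Atom}))%type.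

Definition dynseq (Atom : countType) : Type := {mset component Atom}.

Definition dhs (Atom : countType) : Type := {mset dynseq Atom}.

Definition cpt (Atom : countType) (a : seq (form Atom))
    (M N : {mset form Atom}) : component Atom := (a, (M, N)).

Definition label (Atom : countType) (c : component Atom) : seq (form Atom) :=
  c.1.

Section Calculus.
Variable Atom : countType.
Implicit Types (G : dhs Atom) (X Y : dynseq Atom) (a b : seq (form Atom)).
Implicit Types (M N P Q : {mset form Atom}) (A B : form Atom) (p : Atom).

(* [G | X //_a M => N] is written [(cpt a M N +` X) +` G], and the list of
   announcements [a . A] is [rcons a A].  Each announcement rule is split
   according to whether the conclusion has a component labelled [rcons a A]. *)
Inductive derivable : dhs Atom -> Prop :=
| Ax G X a M N p :
    derivable ((cpt a (Var p +` M) (Var p +` N) +` X) +` G)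
| LNeg G X a M N A :
    derivable ((cpt a M (A +` N) +` X) +` G) ->
    derivable ((cpt a (Neg A +` M) N +` X) +` G)
| RNeg G X a M N A :
    derivable ((cpt a (A +` M) N +` X) +` G) ->
    derivable ((cpt a M (Neg A +` N) +` X) +` G)
| LAnd G X a M N A B :
    derivable ((cpt a (A +` (B +` M)) N +` X) +` G) ->
    derivable ((cpt a (And A B +` M) N +` X) +` G)
| RAnd G X a M N A B :
    derivable ((cpt a M (A +` N) +` X) +` G) ->
    derivable ((cpt a M (B +` N) +` X) +` G) ->
    derivable ((cpt a M (And A B +` N) +` X) +` G)
| LBox1 G X a M N A :
    derivable ((cpt a (Box A +` (A +` M)) N +` X) +` G) ->
    derivable ((cpt a (Box A +` M) N +` X) +` G)
| RBox G X a M N A :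
    derivable ((cpt a M N +` X) +`
               ([mset cpt a mset0 [mset A]] +` G)) ->
    derivable ((cpt a M (Box A +` N) +` X) +` G)
| LBox2 G X Y a M N P Q A :
    derivable ((cpt a (Box A +` M) N +` X) +`
               ((cpt a (A +` P) Q +` Y) +` G)) ->
    derivable ((cpt a (Box A +` M) N +` X) +`
               ((cpt a P Q +` Y) +` G))
(* [b = B_1 ... B_n] with [n >= 1] is [B1 :: b']; [nth B1 b i] is
   [B_(i+1)]. *)
| LBox3 G X Y a M N P Q A B1 (b' : seq (form Atom)) :
    let b := B1 :: b' in
    let Ybar := cpt (a ++ b) (Box A +` P) Q +` Y in
    derivable ((cpt a M (B1 +` N) +` X) +` (Ybar +` G)) ->
    (forall i, 1 <= i < size b ->
       derivable ((cpt a M N +`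
                   (cpt (a ++ take i b) mset0 [mset nth B1 b i] +` X)) +`
                  (Ybar +` G))) ->
    derivable ((cpt a M N +` (cpt (a ++ b) [mset A] mset0 +` X)) +`
               (Ybar +` G)) ->
    derivable ((cpt a M N +` X) +` (Ybar +` G))
| LAnn G X a M N M' N' A B :
    derivable ((cpt a M (A +` N) +` (cpt (rcons a A) M' N' +` X)) +` G) ->
    derivable ((cpt a M N +` (cpt (rcons a A) (B +` M') N' +` X)) +` G) ->
    derivable ((cpt a (Ann A B +` M) N +` (cpt (rcons a A) M' N' +` X)) +` G)
| LAnnNew G X a M N A B :
    (forall c : component Atom, c \in X -> label c <> rcons a A) ->
    derivable ((cpt a M (A +` N) +` X) +` G) ->
    derivable ((cpt a M N +` (cpt (rcons a A) [mset B] mset0 +` X)) +` G) ->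
    derivable ((cpt a (Ann A B +` M) N +` X) +` G)
| RAnn G X a M N M' N' A B :
    derivable ((cpt a (A +` M) N +`
                (cpt (rcons a A) M' (B +` N') +` X)) +` G) ->
    derivable ((cpt a M (Ann A B +` N) +` (cpt (rcons a A) M' N' +` X)) +` G)
| RAnnNew G X a M N A B :
    (forall c : component Atom, c \in X -> label c <> rcons a A) ->
    derivable ((cpt a (A +` M) N +`
                (cpt (rcons a A) mset0 [mset B] +` X)) +` G) ->
    derivable ((cpt a M (Ann A B +` N) +` X) +` G)
| Lat G X a M N M' N' A p :
    derivable ((cpt a (Var p +` M) N +`
                (cpt (rcons a A) (Var p +` M') N' +` X)) +` G) ->
    derivable ((cpt a M N +`
                (cpt (rcons a A) (Var p +` M') N' +` X)) +` G)
| Rat G X a M N M' N' A p :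
    derivable ((cpt a M (Var p +` N) +`
                (cpt (rcons a A) M' (Var p +` N') +` X)) +` G) ->
    derivable ((cpt a M N +`
                (cpt (rcons a A) M' (Var p +` N') +` X)) +` G)
| New G X a M N A :
    derivable ((cpt a mset0 mset0 +` (cpt (rcons a A) M N +` X)) +` G) ->
    derivable ((cpt (rcons a A) M N +` X) +` G)
| Recall G X a M N M' N' A :
    derivable ((cpt a (A +` M) N +` (cpt (rcons a A) M' N' +` X)) +` G) ->
    derivable ((cpt a M N +` (cpt (rcons a A) M' N' +` X)) +` G).

Definition goal A : dhs Atom := [mset [mset cpt [::] mset0 [mset A]]].

End Calculus.

(* Main.v *)
(** Soundness by refutation: a rule whose conclusion is refuted by a model has a
    refuted premise.  A model refutes a DHS at a world [w] when every dynamic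
    sequent is refuted at some world accessible from [w]; it refutes a dynamic
    sequent at [v] when, for each component labelled [a], the world [v] survives
    the announcements [a] and, in the model updated by [a], makes the antecedent
    true and the succedent false.  The updated models are all represented by
    their domains inside the original model, which avoids nested subset types. *)
Require Import Defs.
From Stdlib Require Import Classical Setoid Morphisms.

Set Implicit Arguments.
Unset Strict Implicit.
Unset Printing Implicit Defensive.

Local Open Scope mset_scope.

(** Lets equivalences such as [all_mset1D] be rewritten inside the conjuncts of [[/\ ...]]. *)
#[local] Instance and4_iff_proper :
  Proper (iff ==> iff ==> iff ==> iff ==> iff) and4.
Proof. by move=> ? ? e1 ? ? e2 ? ? e3 ? ? e4; split=> -[/e1 ? /e2 ? /e3 ? /e4 ?]. Qed.

Section AllMset.
Variables (T : choiceType) (P : T -> Prop).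

Definition all_mset (S : {mset T}) : Prop := forall x, x \in S -> P x.

Lemma all_mset0 : all_mset mset0 <-> True.
Proof. by split=> // _ x; rewrite in_mset0. Qed.

Lemma all_mset1 x : all_mset [mset x] <-> P x.
Proof.
split=> [|Px y]; first by apply; rewrite in_mset1.
by rewrite in_mset1 => /eqP ->.
Qed.

Lemma all_mset1D x S : all_mset (x +` S) <-> P x /\ all_mset S.
Proof.
split=> [PxS|[Px PS] y].
  by split=> [|y yS]; apply: PxS; rewrite in_msetD in_mset1 ?eqxx ?yS ?orbT.
by rewrite in_msetD in_mset1 => /orP[/eqP ->|/PS].
Qed.

End AllMset.

Section RelativizedSatisfaction.
Variables (Atom : countType) (M : model Atom).
Implicit Types (D : world M -> Prop) (A B : form Atom) (w : world M).

(** [D] is the domain of the current updated model: [Box] quantifies over it, and an announcement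
    shrinks it for the formula that follows. *)
Fixpoint sat_in D A w : Prop :=
  match A with
  | Var p => val p w
  | Neg B => ~ sat_in D B w
  | And B C => sat_in D B w /\ sat_in D C w
  | Box B => forall v, D v -> acc w v -> sat_in D B v
  | Ann B C => sat_in D B w -> sat_in (fun u => D u /\ sat_in D B u) C w
  end.

Lemma sat_embedding A (M' : model Atom) (f : world M' -> world M) D :
    (forall u v, acc u v <-> acc (f u) (f v)) ->
    (forall p u, val p u <-> val p (f u)) ->
    (forall w, D w <-> exists u, f u = w) ->
  forall u, sat A u <-> sat_in D A (f u).
Proof.
elim: A M' f D => [p|B IHB|B IHB C IHC|B IHB|B IHB C IHC] M' f D facc fval fD u /=.
- exact: fval.
- by rewrite (IHB _ _ _ facc fval fD).
- by rewrite (IHB _ _ _ facc fval fD) (IHC _ _ _ facc fval fD).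
- split=> [satB v /fD[v' <-] /facc uv|satB v uv].
    by apply/(IHB _ _ _ facc fval fD)/satB.
  by apply/(IHB _ _ _ facc fval fD)/satB; [apply/fD; exists v | apply/facc].
- have eqB := IHB _ _ _ facc fval fD.
  (* Composing [f] with the subset projection embeds the updated model; its image is [D] cut down by
     [B]. *)
  pose g (x : world (restrict (fun x : world M' => sat B x))) := f (proj1_sig x).
  have gD w : (D w /\ sat_in D B w) <-> exists x, g x = w.
    split=> [[/fD[v <-] /eqB satv]|[[v satv] <-]]; first by exists (exist _ v satv).
    by split; [apply/fD; exists v | apply/eqB].
  have eqC := IHC _ g _ (fun x y => facc _ _) (fun p x => fval p _) gD.
  split=> [satBC /eqB satu|satBC satu].
    exact: (proj1 (eqC _) (satBC satu)).
  by apply/eqC/satBC/eqB.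
Qed.

Lemma sat_in_full A w : sat A w <-> sat_in (fun=> True) A w.
Proof. by apply: (@sat_embedding A M id) => // v; split=> // _; exists v. Qed.

(** The domain left after the successive announcements, each evaluated in the domain left by the
    earlier ones. *)
Definition survive : seq (form Atom) -> world M -> Prop :=
  foldl (fun D A u => D u /\ sat_in D A u) (fun=> True).

Lemma survive_rcons a A :
  survive (rcons a A) = fun u => survive a u /\ sat_in (survive a) A u.
Proof. exact: foldl_rcons. Qed.

(** Announce [b] one formula at a time and stop at the first false one. The alternatives match the
    premises of [LBox3], whose default [B1] for [nth] is kept. *)
Lemma survive_first_failure a B1 b w : survive a w ->
  survive (a ++ b) w \/
  exists i, [/\ i < size b, survive (a ++ take i b) w
              & ~ sat_in (survive (a ++ take i b)) (nth B1 b i) w].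
Proof.
elim: b a => [|B b IHb] a sa; first by left; rewrite cats0.
have [satB|nsatB] := classic (sat_in (survive a) B w); last first.
  by right; exists 0; rewrite take0 cats0.
have: survive (rcons a B) w by rewrite survive_rcons.
case/IHb=> [|[i [lt_ib]]]; rewrite cat_rcons; first by left.
by move=> si nsat; right; exists i.+1.
Qed.

End RelativizedSatisfaction.

Section Refutation.
Variables (Atom : countType) (M : model Atom).
Implicit Types (w : world M) (X : dynseq Atom) (G : dhs Atom).
Implicit Types (a : seq (form Atom)) (P Q : {mset form Atom}).

Definition refutes_component w (c : component Atom) : Prop :=
  let S := survive (M := M) (label c) in
  [/\ S w, all_mset (fun A => sat_in S A w) c.2.1
    & all_mset (fun A => ~ sat_in S A w) c.2.2].

Definition refutes_dynseq X w : Prop := all_mset (refutes_component w) X.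

(** The witnesses of all dynamic sequents lie in the class of [w], hence are pairwise accessible, as
    the [Box] rules demand. *)
Definition refutes w (G : dhs Atom) : Prop :=
  all_mset (fun X => exists2 v, acc w v & refutes_dynseq X v) G.

Lemma refutes_dynseq1D w a P Q X :
  refutes_dynseq (cpt a P Q +` X) w <->
  [/\ survive a w, all_mset (fun A => sat_in (survive a) A w) P,
      all_mset (fun A => ~ sat_in (survive a) A w) Q & refutes_dynseq X w].
Proof.
rewrite /refutes_dynseq all_mset1D.
by split=> [[[]]|[]].
Qed.

Lemma refutes1D w X G :
  refutes w (X +` G) <->
  (exists2 v, acc w v & refutes_dynseq X v) /\ refutes w G.
Proof. exact: all_mset1D. Qed.

End Refutation.

Lemma derivable_not_refuted (Atom : countType) (G : dhs Atom) :
  derivable G -> forall (M : model Atom) (w : world M), ~ refutes w G.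
Proof.
(* The base world [w0] stays fixed through the induction; only the witnesses of the dynamic sequents
   vary. *)
move=> derG K w0; have [accr accs acct] := acc_equiv K.
elim: derG => {G}.
- move=> G X a M N p /refutes1D[[w _ /refutes_dynseq1D[_ + + _]] _].
  by rewrite !all_mset1D => -[? _] [].
- move=> G X a M N A _ IH /refutes1D[[w w0w /refutes_dynseq1D[sw + rN rX]] rG].
  rewrite all_mset1D => -[nA rM]; apply: IH; apply/refutes1D; split=> //.
  by exists w => //; apply/refutes_dynseq1D; rewrite all_mset1D.
- move=> G X a M N A _ IH /refutes1D[[w w0w /refutes_dynseq1D[sw rM + rX]] rG].
  rewrite all_mset1D => -[/NNPP nA rN]; apply: IH; apply/refutes1D; split=> //.
  by exists w => //; apply/refutes_dynseq1D; rewrite all_mset1D.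
- move=> G X a M N A B _ IH /refutes1D[[w w0w /refutes_dynseq1D[sw + rN rX]] rG].
  rewrite all_mset1D => -[[sA sB] rM]; apply: IH; apply/refutes1D; split=> //.
  by exists w => //; apply/refutes_dynseq1D; rewrite !all_mset1D.
- move=> G X a M N A B _ IHA _ IHB
    /refutes1D[[w w0w /refutes_dynseq1D[sw rM + rX]] rG].
  rewrite all_mset1D => -[/not_and_or[nA|nB] rN]; [apply: IHA|apply: IHB];
    apply/refutes1D; split=> //;
    by exists w => //; apply/refutes_dynseq1D; rewrite all_mset1D.
- move=> G X a M N A _ IH /refutes1D[[w w0w /refutes_dynseq1D[sw + rN rX]] rG].
  rewrite all_mset1D => -[sA rM]; apply: IH; apply/refutes1D; split=> //.
  exists w => //; apply/refutes_dynseq1D; rewrite !all_mset1D.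
  by split=> //; do 2!split=> //; apply: sA.
- move=> G X a M N A _ IH /refutes1D[[w w0w /refutes_dynseq1D[sw rM + rX]] rG].
  (* A surviving world [v] where [A] fails witnesses the new dynamic sequent; transitivity keeps it
     in the class of [w0]. *)
  rewrite all_mset1D => -[nA rN]; apply: nA => v sv wv; apply: NNPP => nA.
  apply: IH; apply/refutes1D; split.
    by exists w => //; apply/refutes_dynseq1D.
  apply/refutes1D; split=> //; exists v; first exact: acct wv.
  by apply/all_mset1; split=> //=; [apply/all_mset0 | apply/all_mset1].
- move=> G X Y a M N P Q A _ IH /refutes1D[[w w0w rw] /refutes1D[[v w0v rv] rG]].
  have /refutes_dynseq1D[sw + _ _] := rw.
  have /refutes_dynseq1D[sv rP rQ rY] := rv.
  rewrite all_mset1D => -[sA _].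
  apply/IH/refutes1D; split; first exact: (ex_intro2 _ _ w w0w rw).
  apply/refutes1D; split; last exact: rG.
  exists v; first exact: w0v.
  apply/refutes_dynseq1D; rewrite all_mset1D; split=> //; split=> //.
  (* [w] and [v] are both accessible from [w0], so [v] is accessible from [w]. *)
  by apply: sA => //; apply: acct w0v; apply: accs.
- move=> G X Y a M N P Q A B1 b' b Ybar _ IH1 _ IHi _ IHA
    /refutes1D[[w w0w /refutes_dynseq1D[sw rM rN rX]] rYG].
  have step X' : refutes_dynseq X' w -> refutes w0 (X' +` (Ybar +` G)).
    by move=> rX'; apply/refutes1D; split=> //; exists w.
  (* If [w] survives all of [b], then [Box A], true at the witness of [Ybar], gives [A] at [w];
     otherwise the first false announcement selects the refuted premise. *)
  have [sb|[i [lt_ib si nB]]] := survive_first_failure B1 b sw.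
    apply/IHA/step/refutes_dynseq1D; split=> //; apply/refutes_dynseq1D.
    split=> //; last exact/all_mset0.
    apply/all_mset1; have /refutes1D[[v w0v rv] _] := rYG.
    move/refutes_dynseq1D: rv => [_ + _ _]; rewrite all_mset1D => -[sA _].
    by apply: sA => //; apply: acct w0w; apply: accs.
  (* Index 0 is separate: [B1] joins the existing component labelled [a], while later formulas open
     a new component. *)
  case: i => [|i] in lt_ib si nB *.
    apply/IH1/step/refutes_dynseq1D; rewrite all_mset1D; split=> //; split=> //.
    by rewrite take0 cats0 in nB.
  apply/(IHi i.+1 lt_ib)/step/refutes_dynseq1D; split=> //.
  by apply/refutes_dynseq1D; split=> //; [apply/all_mset0 | apply/all_mset1].
- move=> G X a M N M' N' A B _ IHA _ IHB
    /refutes1D[[w w0w /refutes_dynseq1D[sw + rN /refutes_dynseq1D[saA rM' rN' rX]]] rG].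
  rewrite all_mset1D => -[sAB rM].
  (* Survival of [rcons a A] at [w] makes [A] true there, so the announcement yields [B] and the
     right premise is refuted. *)
  have [_ sA] : survive a w /\ sat_in (survive a) A w by rewrite survive_rcons in saA.
  apply: IHB; apply/refutes1D; split=> //; exists w => //.
  apply/refutes_dynseq1D; split=> //; apply/refutes_dynseq1D.
  rewrite all_mset1D; split=> //; split=> //.
  by rewrite survive_rcons; apply: sAB.
- move=> G X a M N A B _ _ IHA _ IHB
    /refutes1D[[w w0w /refutes_dynseq1D[sw + rN rX]] rG].
  rewrite all_mset1D => -[sAB rM].
  (* If [A] holds, [w] survives the announcement and witnesses the new component; if not, the left
     premise is refuted. *)
  have [sA|nA] := classic (sat_in (survive a) A w).
    apply: IHB; apply/refutes1D; split=> //; exists w => //.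
    apply/refutes_dynseq1D; split=> //; apply/refutes_dynseq1D.
    rewrite all_mset1 all_mset0 survive_rcons; split=> //.
    exact: sAB.
  apply: IHA; apply/refutes1D; split=> //; exists w => //.
  by apply/refutes_dynseq1D; rewrite all_mset1D.
- move=> G X a M N M' N' A B _ IH
    /refutes1D[[w w0w /refutes_dynseq1D[sw rM + /refutes_dynseq1D[saA rM' rN' rX]]] rG].
  (* A false announcement formula is a false implication: [A] holds at [w], and [B] fails in the
     updated domain. *)
  rewrite all_mset1D => -[nAB rN]; have [sA nB] := imply_to_and (sat_in _ A w) _ nAB.
  apply: IH; apply/refutes1D; split=> //; exists w => //.
  apply/refutes_dynseq1D; rewrite all_mset1D; split=> //.
  apply/refutes_dynseq1D; rewrite all_mset1D; split=> //; split=> //.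
  by rewrite survive_rcons.
- move=> G X a M N A B _ _ IH
    /refutes1D[[w w0w /refutes_dynseq1D[sw rM + rX]] rG].
  rewrite all_mset1D => -[nAB rN]; have [sA nB] := imply_to_and (sat_in _ A w) _ nAB.
  apply: IH; apply/refutes1D; split=> //; exists w => //.
  apply/refutes_dynseq1D; rewrite all_mset1D; split=> //.
  by apply/refutes_dynseq1D; rewrite all_mset1 all_mset0 survive_rcons.
- move=> G X a M N M' N' A p _ IH
    /refutes1D[[w w0w /refutes_dynseq1D[sw rM rN rX]] rG].
  (* The truth of an atom is independent of the domain, so it transfers between labels. *)
  have /refutes_dynseq1D[_ + _ _] := rX; rewrite all_mset1D => -[vp _].
  apply: IH; apply/refutes1D; split=> //; exists w => //.
  by apply/refutes_dynseq1D; rewrite all_mset1D.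
- move=> G X a M N M' N' A p _ IH
    /refutes1D[[w w0w /refutes_dynseq1D[sw rM rN rX]] rG].
  have /refutes_dynseq1D[_ _ + _] := rX; rewrite all_mset1D => -[vp _].
  apply: IH; apply/refutes1D; split=> //; exists w => //.
  by apply/refutes_dynseq1D; rewrite all_mset1D.
- move=> G X a M N A _ IH /refutes1D[[w w0w rX] rG].
  have /refutes_dynseq1D[saA _ _ _] := rX.
  rewrite survive_rcons in saA; case: saA => sw _.
  apply: IH; apply/refutes1D; split=> //; exists w => //.
  by apply/refutes_dynseq1D; rewrite !all_mset0.
- move=> G X a M N M' N' A _ IH
    /refutes1D[[w w0w /refutes_dynseq1D[sw rM rN rX]] rG].
  have /refutes_dynseq1D[saA _ _ _] := rX.
  (* Surviving [rcons a A] records that [A] was true when announced. *)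
  rewrite survive_rcons in saA; case: saA => _ sA.
  apply: IH; apply/refutes1D; split=> //; exists w => //.
  by apply/refutes_dynseq1D; rewrite all_mset1D.
Qed.

Theorem mainTheorem2 (Atom : countType) (A : form Atom) :
  derivable (goal A) -> valid A.
Proof.
move=> derA M w; apply/sat_in_full; apply: NNPP => nA.
apply: (derivable_not_refuted derA (w := w)); apply/all_mset1.
(* The falsifying world is both base point and witness; the empty list of announcements leaves the
   full domain. *)
exists w; first by have [accr _ _] := acc_equiv M.
by apply/all_mset1; split=> //=; [apply/all_mset0 | apply/all_mset1].
Qed.
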